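(* Let a prior network with boundary conditions, positive weights $d_{kl}$ and a material amount $K>0$ be given. Let $(\kappa_{kl})$ be a physical network with $\sum_{k>l,\langle k,l\rangle=1}\kappa_{kl}^{1/2}d_{kl}=K$ that globally minimizes the complementary dissipation $$f=\sum_{k>l,\langle k,l\rangle=1}\frac{Q_{kl}^2}{\kappa_{kl}}-2\sum_{k\in\mathcal P}\bar p_k\sum_{l:\langle k,l\rangle=1}Q_{kl}$$ among all physical networks satisfying this material constraint, where $Q_{kl}$ denotes the Kirchhoff flow of the network. Then the network satisfies Murray's law: there is a constant $a>0$ such that $$\kappa_{kl}=a\,\frac{|Q_{kl}|^{4/3}}{d_{kl}^{2/3}}\qquad\text{for all } \langle k,l\rangle=1 .$$
   Context: Prior network: a finite simple undirected graph on vertices $1,\dots,V$; $\langle k,l\rangle=1$ means $k,l$ are joined by an edge ($\langle k,l\rangle=\langle l,k\rangle$), and $\langle k,l\rangle=0$ otherwise. Each edge carries a fixed weight $d_{kl}=d_{lk}>0$. Boundary conditions: disjoint vertex sets $\mathcal P$ (pressure vertices, each with prescribed pressure $\bar p_k\in\mathbb R$) and $\mathcal F$ (flow vertices, each with prescribed inflow $q_k\in\mathbb R$). Put $q_k=0$ for $k\notin\mathcal P\cup\mathcal F$. A network is a choice of conductances $\kappa_{kl}=\kappa_{lk}\ge 0$ on the edges. A Kirchhoff flow is $Q_{kl}=(p_k-p_l)\kappa_{kl}$ on the edges (so $Q_{kl}=-Q_{lk}$), where the pressures $p_k$ satisfy $p_k=\bar p_k$ for $k\in\mathcal P$ and $\sum_{l:\langle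 k,l\rangle=1}(p_k-p_l)\kappa_{kl}=q_k$ for $k\notin\mathcal P$. The network is physical if there is exactly one Kirchhoff flow (equivalently, every connected component of the graph formed by all vertices and the edges with $\kappa_{kl}>0$ contains a vertex of $\mathcal P$ or has total prescribed inflow zero). Convention: a term $Q_{kl}^2/\kappa_{kl}$ with $\kappa_{kl}=0$ and $Q_{kl}=0$ is $0$.
   Formalization: Assumes in addition that at least one physical network satisfying the material constraint has a nonzero Kirchhoff flow; otherwise every flow vanishes while some conductance is positive, and Murray's law fails. *)

(* Defs.v *)
From HB Require Import structures.
From mathcomp Require Import all_boot all_order all_algebra.
From mathcomp Require Import all_classical all_reals all_analysis.

Set Implicit Arguments.
Unset Strict Implicit.
Unset Printing Implicit Defensive.

Import Order.TTheory GRing.Theory Num.Theory.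

Local Open Scope ring_scope.

(* Vertices are numbered 0, ..., V - 1. The entries of [weight] at pairs that
   are not edges, and of [pbar] outside [pverts], are never used. *)
Record prior_network (R : realType) (V : nat) := PriorNetwork {
  edge : rel 'I_V;
  edge_sym : symmetric edge;
  edge_irr : irreflexive edge;
  weight : 'M[R]_V;
  weight_sym : forall k l, edge k l -> weight k l = weight l k;
  weight_gt0 : forall k l, edge k l -> 0 < weight k l;
  pverts : {set 'I_V};
  fverts : {set 'I_V};
  pf_disjoint : [disjoint pverts & fverts];
  pbar : 'I_V -> R;
  inflow : 'I_V -> R;
  inflow0 : forall k, k \notin pverts :|: fverts -> inflow k = 0
}.

Section Networks.
Variables (R : realType) (V : nat) (N : prior_network R V).

Definition conductances (kappa : 'M[R]_V) : Prop :=
  forall k l, edge N k l -> kappa k l = kappa l k /\ 0 <= kappa k l.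

(* The flow is extended by 0 to the pairs that are not edges, so that equality
   of matrices is equality of the flows on the edges; the pressures themselves
   need not be unique. *)
Definition kirchhoff_flow (kappa Q : 'M[R]_V) : Prop :=
  exists p : 'I_V -> R,
    [/\ forall k, k \in pverts N -> p k = pbar N k,
        forall k, k \notin pverts N ->
          \sum_(l < V | edge N k l) (p k - p l) * kappa k l = inflow N k
      & forall k l,
          Q k l = if edge N k l then (p k - p l) * kappa k l else 0].

Definition physical (kappa : 'M[R]_V) : Prop :=
  conductances kappa /\ exists! Q, kirchhoff_flow kappa Q.

Definition material (kappa : 'M[R]_V) : R :=
  \sum_(k < V) \sum_(l < V | (l < k)%N && edge N k l)
    kappa k l `^ (1 / 2) * weight N k l.

Definition admissible (K : R) (kappa : 'M[R]_V) : Prop :=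
  physical kappa /\ material kappa = K.

(* Since x / 0 = 0 in a field, an edge with zero conductance, and hence zero
   flow, contributes 0 to the first sum. *)
Definition complementary_dissipation (kappa Q : 'M[R]_V) : R :=
  \sum_(k < V) \sum_(l < V | (l < k)%N && edge N k l) Q k l ^+ 2 / kappa k l
  - 2 * \sum_(k in pverts N) pbar N k * \sum_(l < V | edge N k l) Q k l.

Definition global_minimizer (K : R) (kappa Q : 'M[R]_V) : Prop :=
  [/\ admissible K kappa, kirchhoff_flow kappa Q
    & forall kappa' Q' : 'M[R]_V,
        admissible K kappa' -> kirchhoff_flow kappa' Q' ->
        complementary_dissipation kappa Q <=
        complementary_dissipation kappa' Q'].

(* This excludes the case in which no admissible network carries any flow (no
   inflow, and equal pressures within each connected component of the prior
   graph): there every admissible network is a minimizer with Q = 0, and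
   Murray's law would force all conductances to vanish. *)
Definition nontrivial_boundary (K : R) : Prop :=
  exists kappa Q : 'M[R]_V,
    [/\ admissible K kappa, kirchhoff_flow kappa Q & Q != 0].

End Networks.

(* Main.v *)
(* For fixed conductances the Kirchhoff flow minimizes f among all flows with
   the prescribed inflows (Thomson's principle), so replacing the optimal
   conductances by those that Murray's law assigns to the optimal flow Q, scaled
   to the same material, and then Q by the new Kirchhoff flow, cannot lower f.
   With u = kappa^(1/2) and a Lagrange multiplier c, each edge costs
   Q^2 / u^2 + c d u, whose unique minimizer u^3 = 2 Q^2 / (c d) is Murray's law;
   hence every edge must already be at its minimum.
   The case Q = 0 is excluded because then there is no inflow, and f is
   - \sum Q'^2 / kappa' < 0 on a network with a nonzero Kirchhoff flow Q'. *)

Require Import Defs.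
From mathcomp Require Import all_boot all_order all_algebra.
From mathcomp Require Import all_classical all_reals all_analysis.
From mathcomp Require Import ring lra.
Import Order.TTheory GRing.Theory Num.Theory.
Local Open Scope ring_scope.

(** * Sums over edges and summation by parts *)

Section Flows.
Context {R : realType} {V : nat} (N : prior_network R V).
Implicit Types (kappa Q F : 'M[R]_V) (r : 'I_V -> R).

Definition edge_sum (f : 'I_V -> 'I_V -> R) : R :=
  \sum_(k < V) \sum_(l < V | (l < k)%N && edge N k l) f k l.

Definition divergence (f : 'I_V -> 'I_V -> R) (k : 'I_V) : R :=
  \sum_(l < V | edge N k l) f k l.

Lemma eq_edge_sum (f g : 'I_V -> 'I_V -> R) :
  (forall k l, edge N k l -> f k l = g k l) -> edge_sum f = edge_sum g.
Proof.
by move=> fg; apply: eq_bigr => k _; apply: eq_bigr => l /andP[_ /fg].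
Qed.

Lemma edge_sumD (f g : 'I_V -> 'I_V -> R) :
  edge_sum (fun k l => f k l + g k l) = edge_sum f + edge_sum g.
Proof. by rewrite -big_split; apply: eq_bigr => k _; rewrite big_split. Qed.

Lemma edge_sumZ (a : R) (f : 'I_V -> 'I_V -> R) :
  edge_sum (fun k l => a * f k l) = a * edge_sum f.
Proof. by rewrite mulr_sumr; apply: eq_bigr => k _; rewrite mulr_sumr. Qed.

Lemma edge_sum_ge0 (f : 'I_V -> 'I_V -> R) :
  (forall k l, edge N k l -> 0 <= f k l) -> 0 <= edge_sum f.
Proof.
by move=> f0; apply: sumr_ge0 => k _; apply: sumr_ge0 => l /andP[_ /f0].
Qed.

(** Nonnegative terms with a nonpositive sum all vanish. The sum only sees the orientation [l < k];
    symmetry of [f] transfers the conclusion to the other one. *)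
Lemma edge_sum_le0_eq0 (f : 'I_V -> 'I_V -> R) :
    (forall k l, edge N k l -> f k l = f l k) ->
    (forall k l, edge N k l -> 0 <= f k l) -> edge_sum f <= 0 ->
  forall k l, edge N k l -> f k l = 0.
Proof.
move=> fC f0 sf.
have {sf} : edge_sum f = 0 by apply/eqP; rewrite eq_le sf edge_sum_ge0.
have in0 (k : 'I_V) : 0 <= \sum_(l < V | (l < k)%N && edge N k l) f k l.
  by apply: sumr_ge0 => l /andP[_ /f0].
move=> /eqP; rewrite psumr_eq0 // => /allP s0.
have lt0 (k l : 'I_V) : (l < k)%N -> edge N k l -> f k l = 0.
  move=> lk kl; have := s0 k (mem_index_enum k).
  rewrite /= psumr_eq0 => [/allP/(_ l (mem_index_enum l))|j /andP[_ /f0]//].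
  by rewrite lk kl => /eqP.
move=> k l kl; case: (ltngtP l k) => [lk|kl'|/val_inj lk]; first exact: lt0.
  by rewrite fC // lt0 // edge_sym.
by move: kl; rewrite lk edge_irr.
Qed.

(** Summing over vertices meets each edge once from either end; exchanging the two sums brings the
    pairs with [k < l] to the orientation [l < k]. *)
Lemma sum_edges (f : 'I_V -> 'I_V -> R) :
  \sum_k divergence f k = edge_sum (fun k l => f k l + f l k).
Proof.
rewrite edge_sumD /edge_sum.
rewrite [X in _ = _ + X](exchange_big_dep xpredT) //= -big_split /=.
apply: eq_bigr => k _; rewrite /divergence (bigID (fun l : 'I_V => (l < k)%N)) /=.
congr (_ + _); apply: eq_bigl => l; first by rewrite andbC.
rewrite (@edge_sym _ _ N l k) -leqNgt andbC leq_eqVlt.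
by case: (eqVneq (k : nat) l) => [/val_inj->|]//=; rewrite edge_irr !andbF.
Qed.

Lemma sum_by_parts (f : 'I_V -> 'I_V -> R) r :
    (forall k l, edge N k l -> f l k = - f k l) ->
  \sum_k r k * divergence f k = edge_sum (fun k l => (r k - r l) * f k l).
Proof.
move=> fN; transitivity (\sum_k divergence (fun k l => r k * f k l) k).
  by apply: eq_bigr => k _; rewrite mulr_sumr.
rewrite sum_edges; apply: eq_edge_sum => k l /fN ->; ring.
Qed.

(** * Uniqueness and existence of the Kirchhoff flow *)

Lemma gradient_anti kappa r : conductances N kappa ->
  forall k l, edge N k l ->
    (r l - r k) * kappa l k = - ((r k - r l) * kappa k l).
Proof. by move=> ck k l /ck[-> _]; ring. Qed.

(** Energy argument: by parts, the energy of [r] is the sum of [r] times its divergence, and at each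
    vertex one of the two factors is 0. Only the flow vanishes: [r] may jump across edges of zero
    conductance. *)
Lemma harmonic_gradient_eq0 kappa r : conductances N kappa ->
    (forall k, k \in pverts N -> r k = 0) ->
    (forall k, k \notin pverts N ->
       divergence (fun k l => (r k - r l) * kappa k l) k = 0) ->
  forall k l, edge N k l -> (r k - r l) * kappa k l = 0.
Proof.
move=> ck rP rF.
have E0 : edge_sum (fun k l => (r k - r l) * ((r k - r l) * kappa k l)) = 0.
  rewrite -sum_by_parts; last exact: gradient_anti.
  apply: big1 => k _; case: (boolP (k \in pverts N)) => kP.
    by rewrite rP // mul0r.
  by rewrite rF // mulr0.
move=> k l kl.
have /(_ k l kl) : forall k l, edge N k l ->
    (r k - r l) * ((r k - r l) * kappa k l) = 0.
  apply: edge_sum_le0_eq0; last by rewrite E0.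
  - by move=> i j /ck[-> _]; ring.
  - by move=> i j /ck[_ c0]; rewrite mulrA mulr_ge0 // -expr2 sqr_ge0.
by move=> /eqP; rewrite mulf_eq0 => /orP[/eqP->|/eqP->//]; rewrite mul0r.
Qed.

(** The competitors in Thomson's principle: flows that need not derive from pressures. The last
    clause is essential since [x / 0 = 0] would make flow through a zero conductance free. *)
Definition feasible_flow kappa F : Prop :=
  [/\ forall k l, edge N k l -> F l k = - F k l,
      forall k, k \notin pverts N -> divergence F k = inflow N k
    & forall k l, edge N k l -> kappa k l = 0 -> F k l = 0].

Lemma kirchhoff_feasible kappa Q :
  conductances N kappa -> kirchhoff_flow N kappa Q -> feasible_flow kappa Q.
Proof.
move=> ck [p [_ pF QE]]; split.
- by move=> k l kl; rewrite !QE edge_sym kl; apply: gradient_anti.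
- move=> k kF; rewrite -pF //; apply: eq_bigr => l kl.
  by rewrite QE kl.
- by move=> k l kl k0; rewrite QE kl k0 mulr0.
Qed.

Lemma kirchhoff_unique kappa Q Q' : conductances N kappa ->
  kirchhoff_flow N kappa Q -> kirchhoff_flow N kappa Q' -> Q = Q'.
Proof.
move=> ck [p [pP pF QE]] [p' [pP' pF' QE']].
apply/matrixP => k l; rewrite QE QE'; case: ifP => // kl.
apply/eqP; rewrite -subr_eq0 -mulrBl; apply/eqP.
have -> : p k - p l - (p' k - p' l) = (p k - p' k) - (p l - p' l) by ring.
apply: (@harmonic_gradient_eq0 kappa (fun k => p k - p' k)) kl => //.
- by move=> j jP; rewrite pP // pP' // subrr.
- move=> j jF; apply/eqP.
  rewrite -(subrr (inflow N j)) -{1}pF // -pF' // -sumrB; apply/eqP.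
  by apply: eq_bigr => i _; ring.
Qed.

(* The linear system for the pressures is solvable because its right-hand side
   is orthogonal to the cokernel: a vector of the cokernel vanishes on the
   pressure vertices and is constant along conducting edges, while the inflow
   is the divergence of a flow supported on those edges. *)
Lemma kirchhoff_exists kappa F : conductances N kappa ->
  feasible_flow kappa F -> exists Q, kirchhoff_flow N kappa Q.
Proof.
move=> ck [FN Fdiv Fsupp].
pose c k l := if edge N k l then kappa k l else 0.
have cC k l : c k l = c l k.
  by rewrite /c (@edge_sym _ _ N l k); case: ifP => // /ck[].
(* The weighted graph Laplacian. *)
pose L k l := (k == l)%:R * (\sum_j c k j) - c k l.
have LC k l : L k l = L l k.
  by rewrite /L cC eq_sym; case: eqVneq => [->//|]; rewrite !mul0r.
have LE r k : \sum_l L k l * r l =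
    divergence (fun k l => (r k - r l) * kappa k l) k.
  rewrite /divergence [RHS]big_mkcond /=.
  under eq_bigr do rewrite mulrBl.
  have diag C : \sum_l (k == l)%:R * C * r l = C * r k.
    rewrite (bigD1 k) //= eqxx mul1r big1 ?addr0 // => j /negPf jk.
    by rewrite eq_sym jk !mul0r.
  rewrite sumrB diag.
  rewrite mulr_suml -sumrB; apply: eq_bigr => j _.
  by rewrite /c; case: ifP => _; ring.
(* Column [k] is the equation at vertex [k], so that solvability becomes membership of [b] in the
   row space of [M]. *)
pose M : 'M[R]_V := \matrix_(l, k)
  if k \in pverts N then (k == l)%:R else L k l.
pose b : 'rV[R]_V := \row_k if k \in pverts N then pbar N k else inflow N k.
suff /submxP[p pE] : (b <= M)%MS.
  have bE k : b 0 k = \sum_l p 0 l * M l k by rewrite pE mxE.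
  exists (\matrix_(k, l) if edge N k l then (p 0 k - p 0 l) * kappa k l else 0).
  exists (fun k => p 0 k); split; last by move=> k l; rewrite mxE.
  - move=> k kP; have := bE k; rewrite mxE kP => ->.
    rewrite (bigD1 k) //= mxE kP eqxx mulr1 big1 ?addr0 // => j jk.
    by rewrite mxE kP eq_sym (negPf jk) mulr0.
  - move=> k kF; have := bE k; rewrite mxE (negPf kF) => ->.
    rewrite -[LHS](LE (fun k => p 0 k)); apply: eq_bigr => l _.
    by rewrite mxE (negPf kF) mulrC.
rewrite submxE; apply/eqP/matrixP => i j; rewrite [RHS]mxE mxE ord1 {i}.
set y := cokermx M.
have yE l : \sum_k M l k * y k j = 0.
  by have /matrixP/(_ l j) := mulmx_coker M; rewrite !mxE.
(* At the other vertices, [M *m y = 0] says that [z] is harmonic; at a pressure vertex it gives [y]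
   as minus the divergence of the flow driven by [z], which is 0. *)
pose z k := if k \in pverts N then 0 else y k j.
have My l : \sum_k M l k * y k j =
    (if l \in pverts N then y l j else 0) + \sum_k L l k * z k.
  rewrite (bigID (mem (pverts N))) /=; congr (_ + _).
    rewrite big_mkcond (bigD1 l) //= mxE; case: ifP => lP.
      rewrite lP eqxx mul1r big1 ?addr0 // => k kl; case: ifP => // kP.
      by rewrite mxE kP (negPf kl) mul0r.
    rewrite add0r big1 // => k kl; case: ifP => // kP.
    by rewrite mxE kP (negPf kl) mul0r.
  rewrite big_mkcond; apply: eq_bigr => k _; rewrite /z mxE.
  by case: ifP => [/negPf->|/negbFE ->]; rewrite ?mulr0 // LC.
have zgrad : forall k l, edge N k l -> (z k - z l) * kappa k l = 0.
  apply: harmonic_gradient_eq0 => // k kP; first by rewrite /z kP.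
  by have := yE k; rewrite My (negPf kP) add0r LE.
have yP k : k \in pverts N -> y k j = 0.
  move=> kP; have := yE k; rewrite My kP LE /divergence big1 ?addr0 // => l.
  exact: zgrad.
transitivity (\sum_k z k * divergence F k).
  apply: eq_bigr => k _; rewrite mxE /z; case: ifPn => kP.
    by rewrite yP // mulr0 mul0r.
  by rewrite Fdiv // mulrC.
rewrite sum_by_parts // /edge_sum; apply: big1 => k _; apply: big1 => l /andP[_ kl].
have /eqP := zgrad k l kl; rewrite mulf_eq0 => /orP[/eqP->|/eqP k0].
  by rewrite mul0r.
by rewrite Fsupp // mulr0.
Qed.

(** Uniqueness holds for all conductances, so exhibiting one feasible flow certifies that a
    competing network is physical. *)
Lemma feasible_physical kappa F :
  conductances N kappa -> feasible_flow kappa F -> physical N kappa.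
Proof.
move=> ck fF; split=> //; have [Q kQ] := kirchhoff_exists _ _ ck fF.
by exists Q; split=> // Q'; apply: kirchhoff_unique.
Qed.

(** * Dissipation of Kirchhoff flows *)

Lemma complementary_dissipationE kappa Q :
  complementary_dissipation N kappa Q =
    edge_sum (fun k l => Q k l ^+ 2 / kappa k l)
    - 2 * \sum_(k in pverts N) pbar N k * divergence Q k.
Proof. by []. Qed.

(* Thomson's principle. *)
Lemma kirchhoff_dissipation_le kappa Q F : conductances N kappa ->
  kirchhoff_flow N kappa Q -> feasible_flow kappa F ->
  complementary_dissipation N kappa Q <= complementary_dissipation N kappa F.
Proof.
move=> ck kQ [FN Fdiv Fsupp]; have [QN Qdiv Qsupp] := kirchhoff_feasible _ _ ck kQ.
case: kQ => p [pP pF QE].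
(* [F - Q] has divergence only at pressure vertices, where [p] is prescribed, so the cross term is
   exactly the change of the boundary term. *)
have cross : edge_sum (fun k l => (p k - p l) * (F k l - Q k l)) =
    \sum_(k in pverts N) pbar N k * divergence F k
    - \sum_(k in pverts N) pbar N k * divergence Q k.
  rewrite -sum_by_parts; last by move=> k l kl; rewrite FN // QN //; ring.
  have dB k : divergence (fun k l => F k l - Q k l) k =
    divergence F k - divergence Q k by rewrite -sumrB.
  rewrite (bigID (mem (pverts N))) /= [X in _ + X]big1 ?addr0.
    by rewrite -sumrB; apply: eq_bigr => k kP; rewrite pP // dB mulrBr.
  by move=> k kF; rewrite dB Fdiv // Qdiv // subrr mulr0.
have le : 0 <= edge_sum (fun k l => (F k l - Q k l) ^+ 2 / kappa k l).
  by apply: edge_sum_ge0 => k l /ck[_ c0]; rewrite divr_ge0 // sqr_ge0.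
have expand : edge_sum (fun k l => F k l ^+ 2 / kappa k l) =
    edge_sum (fun k l => Q k l ^+ 2 / kappa k l)
    + (2 * edge_sum (fun k l => (p k - p l) * (F k l - Q k l))
    + edge_sum (fun k l => (F k l - Q k l) ^+ 2 / kappa k l)).
  rewrite -edge_sumZ -!edge_sumD; apply: eq_edge_sum => k l kl.
  have [k0|k0] := eqVneq (kappa k l) 0.
    by rewrite Fsupp // Qsupp // k0 invr0; ring.
  by rewrite QE kl; field.
rewrite !complementary_dissipationE expand cross; lra.
Qed.

(** By parts, the boundary sum equals the dissipation [D] itself, and [D - 2 * D = - D]. *)
Lemma kirchhoff_dissipation_no_inflow kappa Q : conductances N kappa ->
    kirchhoff_flow N kappa Q -> (forall k, k \notin pverts N -> inflow N k = 0) ->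
  complementary_dissipation N kappa Q =
    - edge_sum (fun k l => Q k l ^+ 2 / kappa k l).
Proof.
move=> ck kQ q0; have [QN Qdiv Qsupp] := kirchhoff_feasible _ _ ck kQ.
case: kQ => p [pP pF QE].
suff E : \sum_(k in pverts N) pbar N k * divergence Q k =
    edge_sum (fun k l => Q k l ^+ 2 / kappa k l).
  by rewrite complementary_dissipationE E; ring.
transitivity (\sum_k p k * divergence Q k).
  rewrite [RHS](bigID (mem (pverts N))) /= [X in _ = _ + X]big1 ?addr0.
    by apply: eq_bigr => k kP; rewrite pP.
  by move=> k kF; rewrite Qdiv // q0 // mulr0.
rewrite sum_by_parts //; apply: eq_edge_sum => k l kl.
have [k0|k0] := eqVneq (kappa k l) 0.
  by rewrite Qsupp // k0; ring.
by rewrite QE kl; field.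
Qed.

Lemma flow_eq0 Q kappa : kirchhoff_flow N kappa Q ->
  (forall k l, edge N k l -> Q k l = 0) -> Q = 0.
Proof.
move=> [p [_ _ QE]] Q0; apply/matrixP => k l; rewrite mxE.
by case: (boolP (edge N k l)) => [/Q0//|/negPf kl]; rewrite QE kl.
Qed.

Lemma minimizer_flow_neq0 K kappa Q :
  nontrivial_boundary N K -> global_minimizer N K kappa Q -> Q != 0.
Proof.
move=> [kappa1 [Q1 [adm1 kQ1 Q1n0]]] [[[ck _] _] kQ min].
apply: contra Q1n0 => /eqP Q0; apply/eqP; apply: (flow_eq0 Q1 kappa1) => //.
have [[ck1 _] _] := adm1.
have q0 k : k \notin pverts N -> inflow N k = 0.
  have [_ Qdiv _] := kirchhoff_feasible _ _ ck kQ.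
  by move=> /Qdiv <-; rewrite Q0; apply: big1 => l _; rewrite mxE.
have [QN1 _ Qsupp] := kirchhoff_feasible _ _ ck1 kQ1.
have := min _ _ adm1 kQ1.
rewrite !kirchhoff_dissipation_no_inflow // lerN2.
have -> : edge_sum (fun k l => Q k l ^+ 2 / kappa k l) = 0.
  by rewrite Q0; apply: big1 => k _; apply: big1 => l _; rewrite mxE expr0n mul0r.
move=> le k l kl.
have /(_ k l kl)/eqP :
    forall k l, edge N k l -> Q1 k l ^+ 2 / kappa1 k l = 0.
  apply: edge_sum_le0_eq0 => // i j ij.
    by have [-> _] := ck1 _ _ ij; rewrite (QN1 _ _ ij) sqrrN.
  by have [_ c0] := ck1 _ _ ij; rewrite divr_ge0 // sqr_ge0.
(* The quotient is also 0 when [kappa1 k l = 0], but then feasibility forces zero flow. *)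
rewrite mulf_eq0 expf_eq0 invr_eq0 /= => /orP[/eqP//|/eqP].
exact: Qsupp.
Qed.

End Flows.

(** * The cost of a single edge *)

Lemma edge_cost_ge (R : realFieldType) (q u v e : R) :
    0 <= u -> 0 <= v -> 0 < e -> e * v ^+ 3 = 2 * q ^+ 2 ->
    (u = 0 -> q = 0) ->
  q ^+ 2 / v ^+ 2 + e * v <= q ^+ 2 / u ^+ 2 + e * u ?= iff (u == v).
Proof.
move=> u0 v0 e0 ev uq.
have [q0|q0] := eqVneq q 0.
  have v00 : v = 0.
    apply/eqP; have := ev; rewrite q0 expr0n mulr0 => /eqP.
    by rewrite mulf_eq0 expf_eq0 /= (gt_eqF e0).
  rewrite q0 v00 expr0n !mul0r mulr0 !add0r; split; first by rewrite mulr_ge0 // ltW.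
  by rewrite eq_sym mulf_eq0 (gt_eqF e0).
(* At [u = 0] the quotient would count as 0 and break the inequality; the last hypothesis rules this
   out. *)
have un0 : u != 0 by apply: contra q0 => /eqP/uq ->.
have q2 : 0 < q ^+ 2 by rewrite exprn_even_gt0 //= q0.
have vn0 : v != 0.
  apply/eqP => v00; move: ev; rewrite v00 expr0n mulr0 => /esym/eqP.
  by rewrite mulf_eq0 pnatr_eq0 /= (gt_eqF q2).
have up : 0 < u by rewrite lt_neqAle eq_sym un0.
have vp : 0 < v by rewrite lt_neqAle eq_sym vn0.
(* Eliminating [e] by the stationarity condition at [v] makes the difference of costs a positive
   multiple of [(u - v) ^+ 2]. *)
have eE : e = 2 * q ^+ 2 / v ^+ 3 by rewrite -ev; field.
have D : q ^+ 2 / u ^+ 2 + e * u - (q ^+ 2 / v ^+ 2 + e * v) =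
    q ^+ 2 * (2 * u + v) / (u ^+ 2 * v ^+ 3) * (u - v) ^+ 2.
  by rewrite eE; field; rewrite un0 vn0.
have C0 : 0 < q ^+ 2 * (2 * u + v) / (u ^+ 2 * v ^+ 3).
  rewrite divr_gt0 //; first by rewrite mulr_gt0 // addr_gt0 // mulr_gt0.
  by rewrite mulr_gt0 ?exprn_gt0.
split; first by rewrite -subr_ge0 D mulr_ge0 ?sqr_ge0 // ltW.
by rewrite eq_sym -subr_eq0 D mulf_eq0 (gt_eqF C0) expf_eq0 /= subr_eq0.
Qed.

(** * Real powers *)

Section PowR.
Context {R : realType}.
Implicit Types x a : R.

Lemma powRX x a (n : nat) : (x `^ a) ^+ n = x `^ (a * n%:R).
Proof. by rewrite powRrM powR_mulrn // powR_ge0. Qed.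

Lemma sqr_powR_half x : 0 <= x -> (x `^ (1 / 2)) ^+ 2 = x.
Proof. by move=> x0; rewrite powRX divfK ?pnatr_eq0 // powRr1. Qed.

Lemma powR_half_sqr x : 0 <= x -> (x ^+ 2) `^ (1 / 2) = x.
Proof.
by move=> x0; rewrite -powR_mulrn // -powRrM mulrC divfK ?pnatr_eq0 // powRr1.
Qed.

End PowR.

(** * Comparison with the Murray network of the optimal flow *)

Theorem theorem3p5 (R : realType) (V : nat) (N : prior_network R V) (K : R)
    (K_gt0 : 0 < K) (nontrivial : nontrivial_boundary N K)
    (kappa Q : 'M[R]_V) (kappa_min : global_minimizer N K kappa Q) :
  exists a : R, 0 < a /\
    forall k l : 'I_V, edge N k l ->
      kappa k l = a * (`|Q k l| `^ (4 / 3) / weight N k l `^ (2 / 3)).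
Proof.
have Qn0 := minimizer_flow_neq0 N _ _ _ nontrivial kappa_min.
case: kappa_min => -[[ck _] mK] kQ min.
have fQ := kirchhoff_feasible _ _ _ ck kQ; have [QN Qdiv Qsupp] := fQ.
have QC k l : edge N k l -> `|Q l k| = `|Q k l| by move=> /QN ->; rewrite normrN.
(* [g] is the square root of the Murray conductance with constant 1. *)
pose d := weight N; pose g k l := `|Q k l| `^ (2 / 3) / d k l `^ (1 / 3).
have d0 k l : edge N k l -> 0 < d k l := @weight_gt0 _ _ N k l.
have g0 k l : 0 <= g k l by rewrite divr_ge0 // powR_ge0.
have gC k l : edge N k l -> g k l = g l k.
  by move=> kl; rewrite /g (QC _ _ kl) /d (weight_sym kl).
have g2 k l : g k l ^+ 2 = `|Q k l| `^ (4 / 3) / d k l `^ (2 / 3).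
  rewrite expr_div_n powRX powRX.
  by congr (_ `^ _ / _ `^ _); field.
have g3 k l : edge N k l -> d k l * g k l ^+ 3 = Q k l ^+ 2.
  move=> kl; rewrite expr_div_n !powRX.
  have -> : 2 / 3 * 3%:R = 2%:R :> R by field.
  have -> : 1 / 3 * 3%:R = 1 :> R by field.
  rewrite powR_mulrn // powRr1 ?(ltW (d0 _ _ kl)) // real_normK ?num_real //.
  by field; rewrite gt_eqF // d0.
have Q_eq0 k l : edge N k l -> g k l = 0 -> Q k l = 0.
  by move=> kl gkl; apply/eqP; rewrite -sqrf_eq0 -g3 // gkl expr0n mulr0.
pose S := edge_sum N (fun k l => g k l * d k l).
have S_gt0 : 0 < S.
  have gd0 k l : edge N k l -> 0 <= g k l * d k l.
    by move=> kl; rewrite mulr_ge0 // ltW // d0.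
  rewrite lt_neqAle edge_sum_ge0 // andbT eq_sym; apply: contra Qn0 => /eqP S0.
  apply/eqP; apply: (flow_eq0 N _ _ kQ) => k l kl; apply: Q_eq0 => //.
  have /(_ k l kl)/eqP : forall k l, edge N k l -> g k l * d k l = 0.
    apply: edge_sum_le0_eq0 => //; last by rewrite -/S S0.
    by move=> i j ij; rewrite (gC _ _ ij) /d (weight_sym ij).
  by rewrite mulf_eq0 (gt_eqF (d0 _ _ kl)) orbF => /eqP.
(* [S] is the material of the unscaled Murray network; the factor [s] brings it to [K]. *)
pose s := K / S; have s_gt0 : 0 < s by rewrite divr_gt0.
have sg0 k l : 0 <= s * g k l by rewrite mulr_ge0 // ltW.
pose kappa' : 'M[R]_V := \matrix_(k, l) (s * g k l) ^+ 2.
have ck' : conductances N kappa'.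
  by move=> k l kl; rewrite !mxE gC //; split=> //; rewrite sqr_ge0.
(* [kappa'] vanishes only on edges where [Q] does. *)
have fQ' : feasible_flow N kappa' Q.
  split=> // k l kl /eqP; rewrite mxE sqrf_eq0 mulf_eq0 (gt_eqF s_gt0) /=.
  by move=> /eqP; apply: Q_eq0.
have mK' : material N kappa' = K.
  transitivity (edge_sum N (fun k l => s * (g k l * d k l))).
    by apply: eq_edge_sum => k l kl; rewrite mxE powR_half_sqr // mulrA.
  by rewrite edge_sumZ -/S /s divfK // gt_eqF.
have adm' : admissible N K kappa'.
  by split=> //; apply: feasible_physical fQ'.
have [Q' kQ'] := kirchhoff_exists _ _ _ ck' fQ'.
have := le_trans (min _ _ adm' kQ') (kirchhoff_dissipation_le _ _ _ _ ck' kQ' fQ').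
(* Both ends of the chain carry the same flow [Q], so the boundary terms cancel. *)
rewrite !complementary_dissipationE lerD2r => dis.
pose u k l := kappa k l `^ (1 / 2).
have u2 k l : edge N k l -> u k l ^+ 2 = kappa k l.
  by move=> /ck[_]; apply: sqr_powR_half.
(* The multiplier for which [s * g] is stationary: [c * d * (s * g) ^+ 3 = 2 * d * g ^+ 3 = 2 * Q ^+
   2]. *)
pose c := 2 / s ^+ 3; have c_gt0 : 0 < c by rewrite divr_gt0 // exprn_gt0.
pose cost q x w := q ^+ 2 / x ^+ 2 + c * w * x : R.
have cost_min k l : edge N k l ->
    cost (Q k l) (s * g k l) (d k l) <= cost (Q k l) (u k l) (d k l)
      ?= iff (u k l == s * g k l).
  move=> kl; apply: edge_cost_ge; rewrite ?powR_ge0 ?(mulr_gt0 c_gt0) ?d0 //.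
    by rewrite -(g3 _ _ kl) /c; field; rewrite gt_eqF.
  move=> u0; apply: Qsupp => //.
  by rewrite -u2 // u0 expr0n.
pose gap k l := cost (Q k l) (u k l) (d k l) - cost (Q k l) (s * g k l) (d k l).
have gap0 : forall k l, edge N k l -> gap k l = 0.
  apply: edge_sum_le0_eq0.
  - move=> k l kl; rewrite /gap /cost /u -(gC _ _ kl) (QN _ _ kl) sqrrN.
    by rewrite -(ck _ _ kl).1 /d -(weight_sym kl).
  - by move=> k l kl; rewrite subr_ge0 (cost_min _ _ kl).
  (* The multiplier terms cancel, as both networks use material [K]; what remains is [dis]. *)
  - have -> : edge_sum N gap =
        edge_sum N (fun k l => Q k l ^+ 2 / kappa k l)
        + (c * material N kappa
        + (-1 * edge_sum N (fun k l => Q k l ^+ 2 / kappa' k l)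
        + - c * material N kappa')).
      rewrite -!edge_sumZ -!edge_sumD; apply: eq_edge_sum => k l kl.
      rewrite /gap /cost u2 // [kappa' k l]mxE powR_half_sqr //.
      by rewrite -/(u k l) -/(d k l); ring.
    by rewrite mK mK'; lra.
exists (s ^+ 2); split=> [|k l kl]; first exact: exprn_gt0.
rewrite -/(d k l) -g2 -exprMn -u2 //; congr (_ ^+ 2); apply/eqP.
by rewrite -(cost_min _ _ kl) eq_sym -subr_eq0; apply/eqP/gap0.
Qed.
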